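(* Let $D=\mathrm{diag}(d_1,\dots,d_n)$ with all $d_j>0$, $d_{max}=\max_jd_j$, $d_{min}=\min_jd_j$. If $L_->0$ is chosen so that $\lambda_{\mathcal{T}_-}:=\frac{K_-C_M}{\eta_M}e^{-\eta_ML_-}<1$ and $$\frac{\lambda_{\mathcal{T}_-}}{1-\lambda_{\mathcal{T}_-}}<\frac{d_{min}^{1/2}}{d_{max}^{1/2}\,(1+\|\mathcal{M}_-\|d_{max})^{1/2}\sqrt n},$$ then $\mathbb{E}^u_-(x)\cap\mathcal{D}=\{0\}$ for all $x\le-L_-$.
   Context: Let $\mathcal{M}:\mathbb{R}\to\mathbb{R}^{n\times n}$ satisfy: (H1) $\mathcal{M}$ is continuous and $\mathcal{M}(x)$ is real symmetric for each $x$. (H2) The limits $\mathcal{M}_\pm=\lim_{x\to\pm\infty}\mathcal{M}(x)$ exist, are negative definite, and have distinct eigenvalues. (H3) There are positive constants $C_M,\eta_M$ with $|\mathcal{M}(x)-\mathcal{M}_\pm|\le C_Me^{-\eta_M|x|}$ for $x\in\mathbb{R}^\pm$, respectively. Consider the system $$U_x=\tilde{\mathcal{A}}(x)U,\qquad \tilde{\mathcal{A}}(x)=\begin{pmatrix}0&D^{-1}\\-\mathcal{M}(x)&0\end{pmatrix},\qquad U\in\mathbb{R}^{2n}.$$ $\mathbb{E}^u_-(x)\subset\mathbb{R}^{2n}$ is the space of values at $x$ of solutions that tend to $0$ as $x\to-\infty$, and $\mathcal{D}=\{(u,w)\in\mathbb{R}^{2n}:u=0\}$ is the Dirichlet subspace.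 Let $\mathcal{A}_{-\infty}=\begin{pmatrix}0&D^{-1}\\-\mathcal{M}_-&0\end{pmatrix}$. $K_->0$ (with some $\eta_->0$) is a constant such that for every positive eigenvalue $\nu$ of $\mathcal{A}_{-\infty}$, with $P^{cs}$ (resp. $P^u$) the spectral projection of $\mathcal{A}_{-\infty}-\nu$ onto eigenvalues with real part $\le0$ (resp. $>0$), $$\|e^{(\mathcal{A}_{-\infty}-\nu)(x-y)}P^{cs}\|\le K_-\quad(y\le x\le0),\qquad \|e^{(\mathcal{A}_{-\infty}-\nu)(x-y)}P^u\|\le K_-e^{-\eta_-(y-x)}\quad(x\le y\le0).$$ Norms are Euclidean vector norms and the induced operator norms. *)

(* Defs.v *)
From HB Require Import structures.
From mathcomp Require Import all_boot all_order all_algebra.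
From mathcomp Require Import complex.
From mathcomp Require Import all_classical all_reals all_analysis.
Import Order.TTheory GRing.Theory Num.Theory.
Import numFieldNormedType.Exports.

Set Implicit Arguments.
Unset Strict Implicit.
Unset Printing Implicit Defensive.

Local Open Scope classical_set_scope.
Local Open Scope ring_scope.

(** Matrices act on column vectors.  The library's norm [`|A|] on matrices is
    the max norm, so the Euclidean norm and its operator norm are defined here;
    topological notions (limits, derivatives, continuity) use the library
    topology, which is the same in finite dimension. *)

Definition enorm (R : realType) (m : nat) (v : 'cV[R]_m) : R :=
  Num.sqrt (\sum_i v i 0 ^+ 2).

Definition opnorm (R : realType) (m : nat) (A : 'M[R]_m) : R :=
  sup [set enorm (A *m v) | v in [set v | enorm v <= 1]].

Definition expmx (R : realType) (m : nat) (A : 'M[R]_m) : 'M[R]_m :=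
  limn (series (fun k : nat => (k`!%:R : R)^-1 *: A ^+ k)).

Definition negative_definite (R : realType) (m : nat) (A : 'M[R]_m) : Prop :=
  forall v : 'cV[R]_m, v != 0 -> (v^T *m A *m v) 0 0 < 0.

(** The list of roots of the characteristic polynomial, with multiplicity, has
    no repetition. *)
Definition distinct_eigenvalues (R : realType) (m : nat) (A : 'M[R]_m) : Prop :=
  exists2 s : seq R, char_poly A = \prod_(a <- s) ('X - a%:P) & uniq s.

(** [P] is the identity on the generalized eigenvectors of [A] (over the complex
    numbers) for eigenvalues in [S], and zero on those for the other
    eigenvalues.  Generalized eigenvectors span, so there is one such [P]. *)
Definition is_spectral_projection (R : realType) (m : nat)
    (S : set R[i]) (A P : 'M[R]_m) : Prop :=
  let AC := map_mx (real_complex R) A in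
  let PC := map_mx (real_complex R) P in
  forall (a : R[i]) (v : 'cV[R[i]]_m), (AC - a%:M) ^+ m *m v = 0 ->
    (S a -> PC *m v = v) /\ (~ S a -> PC *m v = 0).

Definition dichotomy_bounds (R : realType) (m : nat) (A : 'M[R]_m)
    (K eta : R) : Prop :=
  forall nu : R, eigenvalue A nu -> 0 < nu ->
  forall Pcs Pu : 'M[R]_m,
    is_spectral_projection [set a | complex.Re a <= 0] (A - nu%:M) Pcs ->
    is_spectral_projection [set a | 0 < complex.Re a] (A - nu%:M) Pu ->
    (forall x y : R, y <= x -> x <= 0 ->
       opnorm (expmx ((x - y) *: (A - nu%:M)) *m Pcs) <= K) /\
    (forall x y : R, x <= y -> y <= 0 ->
       opnorm (expmx ((x - y) *: (A - nu%:M)) *m Pu)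
         <= K * expR (- eta * (y - x))).

(** The first [n] coordinates of [U] are [u], the last [n] are [w]. *)
Definition coef_mx (R : realType) (n : nat) (d : 'rV[R]_n) (M : 'M[R]_n) :
    'M[R]_(n + n) :=
  block_mx 0 (invmx (diag_mx d)) (- M) 0.

Definition Eu_minus (R : realType) (m : nat) (A : R -> 'M[R]_m) (x : R) :
    set 'cV[R]_m :=
  [set V | exists U : R -> 'cV[R]_m,
    [/\ forall t : R, is_derive t 1 U (A t *m U t),
        U t @[t --> -oo] --> (0 : 'cV[R]_m)
      & U x = V]].

Definition Dirichlet (R : realType) (n : nat) : set 'cV[R]_(n + n) :=
  [set U | usubmx U = 0].

(** Used for positive entries and [0 < n], so the default values are neutral. *)
Definition dmax (R : realType) (n : nat) (d : 'rV[R]_n) : R :=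
  \big[Num.max/0]_j d 0 j.

Definition dmin (R : realType) (n : nat) (d : 'rV[R]_n) : R :=
  \big[Num.min/dmax d]_j d 0 j.

Definition lambdaT (R : realType) (K C eta L : R) : R :=
  K * C / eta * expR (- eta * L).

(* Main.v *)
(** Put [A = coef_mx d Mm].  There is a symmetric [H] with [H D^-1 H = - Mm], so that
    [D^-1 H] is the positive square root of [- D^-1 Mm] and the spectral projection
    of [A] onto its positive eigenvalues has upper right block [H^-1 / 2].  Comparing
    [e^{t (A - nu)} Pcs] at [t = 0] and [t = +oo], for the smallest positive
    eigenvalue [nu], the dichotomy bounds give [H^-1 <= 4 Km], that is,
    [|u|^2 <= 4 Km (u . H u)].

    Along a solution [(u, w)], completing the square in [|D^{-1/2} (w -+ H u)|^2 >= 0]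
    shows that the derivatives of [u . w -+ u . H u] are at least
    [- CM e^{etaM t} |u|^2].  If the solution tends to [0] at [-oo] and [u x = 0],
    integrating from [-oo] to a maximum point [z] of [|u|^2] on [`]-oo, x]], and from
    [z] to [x], gives [2 (u . H u) z <= (CM / etaM) e^{etaM x} |u z|^2], which together
    with the bound on [|u|^2] yields [|u z|^2 <= 2 lambda |u z|^2] with [2 lambda < 1].
    Hence [u = 0] on [`]-oo, x]], and then [w x = D u' x = 0]. *)

Require Import Defs.
From HB Require Import structures.
From mathcomp Require Import all_boot all_order all_algebra.
From mathcomp Require Import complex.
From mathcomp Require Import all_classical all_reals all_analysis.
From mathcomp Require Import ring lra.
Import Order.TTheory GRing.Theory Num.Theory.
Import numFieldNormedType.Exports.

Local Open Scope classical_set_scope.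
Local Open Scope ring_scope.

(** * Euclidean inner product, Cauchy-Schwarz and the operator norm *)

Section Dot.
Context {R : realType}.

Definition dot {m : nat} (u v : 'cV[R]_m) : R := (u^T *m v) 0 0.

Lemma dotE m (u v : 'cV[R]_m) : dot u v = \sum_i u i 0 * v i 0.
Proof. by rewrite /dot mxE; apply: eq_bigr => i _; rewrite mxE. Qed.

Lemma dotC m (u v : 'cV[R]_m) : dot u v = dot v u.
Proof. by rewrite !dotE; apply: eq_bigr => i _; rewrite mulrC. Qed.

Lemma dotDl m (u v w : 'cV[R]_m) : dot (u + v) w = dot u w + dot v w.
Proof. by rewrite /dot linearD mulmxDl mxE. Qed.

Lemma dotDr m (u v w : 'cV[R]_m) : dot w (u + v) = dot w u + dot w v.
Proof. by rewrite /dot mulmxDr mxE. Qed.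

Lemma dotNl m (u v : 'cV[R]_m) : dot (- u) v = - dot u v.
Proof. by rewrite /dot linearN mulNmx mxE. Qed.

Lemma dotNr m (u v : 'cV[R]_m) : dot u (- v) = - dot u v.
Proof. by rewrite /dot mulmxN mxE. Qed.

Lemma dotZl m a (u v : 'cV[R]_m) : dot (a *: u) v = a * dot u v.
Proof. by rewrite /dot linearZ -scalemxAl mxE. Qed.

Lemma dotZr m a (u v : 'cV[R]_m) : dot u (a *: v) = a * dot u v.
Proof. by rewrite /dot -scalemxAr mxE. Qed.

Lemma dot0r m (u : 'cV[R]_m) : dot u 0 = 0.
Proof. by rewrite /dot mulmx0 mxE. Qed.

Lemma dot0l m (u : 'cV[R]_m) : dot 0 u = 0.
Proof. by rewrite dotC dot0r. Qed.

Lemma dot_sumr m (I : finType) (P : pred I) (u : 'cV[R]_m) (F : I -> 'cV[R]_m) :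
  dot u (\sum_(i | P i) F i) = \sum_(i | P i) dot u (F i).
Proof. by rewrite /dot mulmx_sumr summxE. Qed.

Lemma dot_mulmxr m p (A : 'M[R]_(m, p)) (u : 'cV[R]_m) (v : 'cV[R]_p) :
  dot u (A *m v) = dot (A^T *m u) v.
Proof. by rewrite /dot trmx_mul trmxK mulmxA. Qed.

Lemma dot_col_mx m p (a c : 'cV[R]_m) (b e : 'cV[R]_p) :
  dot (col_mx a b) (col_mx c e) = dot a c + dot b e.
Proof.
rewrite !dotE big_split_ord /=.
by congr (_ + _); apply: eq_bigr => i _; rewrite ?col_mxEu ?col_mxEd.
Qed.

Lemma dot_ge0 m (u : 'cV[R]_m) : 0 <= dot u u.
Proof. by rewrite dotE; apply: sumr_ge0 => i _; rewrite -expr2 sqr_ge0. Qed.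

Lemma dot_eq0 m (u : 'cV[R]_m) : dot u u = 0 -> u = 0.
Proof.
rewrite dotE => /eqP; rewrite psumr_eq0; last by move=> i _; rewrite -expr2 sqr_ge0.
move=> /allP u0; apply/colP => i; rewrite mxE; apply/eqP.
by move: (u0 i (mem_index_enum _)); rewrite mulf_eq0 orbb.
Qed.

Lemma sqr_enorm m (u : 'cV[R]_m) : enorm u ^+ 2 = dot u u.
Proof.
rewrite /enorm dotE sqr_sqrtr; first by apply: eq_bigr => i _; rewrite expr2.
by apply: sumr_ge0 => i _; rewrite sqr_ge0.
Qed.

Lemma enorm_ge0 m (u : 'cV[R]_m) : 0 <= enorm u.
Proof. exact: sqrtr_ge0. Qed.

Lemma enormZ m a (u : 'cV[R]_m) : enorm (a *: u) = `|a| * enorm u.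
Proof.
apply/eqP; rewrite -(@eqrXn2 _ 2) ?mulr_ge0 ?enorm_ge0//.
by rewrite exprMn !sqr_enorm dotZl dotZr mulrA -expr2 real_normK// num_real.
Qed.

(** Cauchy-Schwarz: the square norm of [dot v v *: u - dot u v *: v] is nonnegative and equals
    [dot v v] times the difference of the two sides. *)
Lemma sqr_dot_le m (u v : 'cV[R]_m) : dot u v ^+ 2 <= dot u u * dot v v.
Proof.
have [v0|vn0] := eqVneq (dot v v) 0.
  by rewrite (dot_eq0 _ _ v0) !dot0r mulr0 expr0n.
have v_gt0 : 0 < dot v v by rewrite lt_def vn0 dot_ge0.
have := dot_ge0 _ (dot v v *: u - dot u v *: v).
rewrite !(dotDl, dotDr, dotNl, dotNr, dotZl, dotZr) (dotC _ v u) => h.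
rewrite -subr_ge0 -(pmulr_rge0 _ v_gt0); apply: le_trans h _.
by rewrite le_eqVlt; apply/orP; left; apply/eqP; ring.
Qed.

Lemma dot_le_enorm m (u v : 'cV[R]_m) : `|dot u v| <= enorm u * enorm v.
Proof.
rewrite -(@ler_pXn2r _ 2) ?nnegrE ?mulr_ge0 ?enorm_ge0//.
by rewrite exprMn !sqr_enorm real_normK ?num_real// sqr_dot_le.
Qed.

(** Cauchy-Schwarz on each row gives the Frobenius norm as an upper bound. Without boundedness the
    [sup] in [opnorm] would carry no information. *)
Lemma opnorm_has_ubound m (A : 'M[R]_m) :
  has_ubound [set enorm (A *m v) | v in [set v | enorm v <= 1]].
Proof.
exists (Num.sqrt (\sum_i dot (row i A)^T (row i A)^T)) => _ [v /= v1 <-].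
rewrite /enorm; apply: ler_wsqrtr; apply: ler_sum => i _.
have -> : (A *m v) i 0 = dot (row i A)^T v.
  by rewrite /dot trmxK -row_mul [RHS]mxE.
apply: le_trans (sqr_dot_le _ _ _) _.
by rewrite ler_piMr ?dot_ge0// -sqr_enorm -(expr1n _ 2) ler_pXn2r ?nnegrE ?enorm_ge0.
Qed.

Lemma enorm_mulmx m (A : 'M[R]_m) (v : 'cV[R]_m) :
  enorm (A *m v) <= opnorm A * enorm v.
Proof.
have [v0|vn0] := eqVneq (enorm v) 0.
  have -> : v = 0 by apply: (@dot_eq0 m); rewrite -sqr_enorm v0 expr0n.
  rewrite mulmx0 -[X in enorm X <= _](scale0r 0) enormZ normr0 mul0r.
  by rewrite -[X in enorm X](scale0r (0 : 'cV_m)) enormZ normr0 mul0r mulr0.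
have v_gt0 : 0 < enorm v by rewrite lt_def vn0 enorm_ge0.
rewrite -ler_pdivrMr// mulrC -[(enorm v)^-1]ger0_norm ?invr_ge0 ?enorm_ge0//.
rewrite -enormZ scalemxAr; apply: ub_le_sup; first exact: opnorm_has_ubound.
exists ((enorm v)^-1 *: v) => //=.
by rewrite enormZ ger0_norm ?invr_ge0 ?enorm_ge0// mulVf.
Qed.

Lemma opnorm_ge0 m (A : 'M[R]_m) : 0 <= opnorm A.
Proof.
apply: le_trans (enorm_ge0 m (A *m 0)) _; apply: ub_le_sup; first exact: opnorm_has_ubound.
exists 0 => //=.
by rewrite -[X in enorm X](scale0r (0 : 'cV_m)) enormZ normr0 mul0r ler01.
Qed.

Lemma dot_opnorm m (A : 'M[R]_m) (u v : 'cV[R]_m) :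
  `|dot u (A *m v)| <= opnorm A * (enorm u * enorm v).
Proof.
apply: le_trans (dot_le_enorm _ _ _) _; rewrite mulrCA ler_wpM2l ?enorm_ge0//.
exact: enorm_mulmx.
Qed.

End Dot.

(** * Spectral resolution of real symmetric matrices *)

Section Resolution.
Context {R : realType}.

(** Diagonalizability of [A] over the reals, expressed by complementary projections onto
    eigenspaces. The [r i] may coincide and a [P i] may vanish, so the notion survives scaling of
    [A], even by 0. *)
Definition resolution {I : finType} {m : nat} (A : 'M[R]_m) (r : I -> R)
    (P : I -> 'M[R]_m) : Prop :=
  [/\ forall i j, P i *m P j = if i == j then P i else 0,
      \sum_i P i = 1%:M & A = \sum_i r i *: P i].

Lemma horner_mx_sym n (N : 'M[R]_n.+1) (p : {poly R}) :
  N^T = N -> (horner_mx N p)^T = horner_mx N p.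
Proof.
move=> symN; elim/poly_ind: p => [|p c IH]; first by rewrite rmorph0 linear0.
rewrite rmorphD rmorphM /= horner_mx_X horner_mx_C linearD /= tr_scalar_mx.
congr (_ + _); rewrite trmx_mul IH symN.
exact: (comm_mx_horner p (comm_mx_refl N)).
Qed.

(** Over [C] the matrix is Hermitian, hence unitarily diagonalizable with real eigenvalues [r i],
    and a polynomial in it is diagonal with entries [p.[r i]]. Identities between real polynomials
    in [N] can then be checked pointwise on the spectrum. *)
Lemma horner_mx_spectral (C : numClosedFieldType) (f : {rmorphism R -> C})
    (f_real : forall x, f x \is Num.real)
    (f_surj : forall z, z \is Num.real -> exists x, z = f x)
    n (N : 'M[R]_n.+1) : N^T = N ->
  exists r : 'I_n.+1 -> R, forall p q : {poly R},
    horner_mx N p = horner_mx N q <-> forall i, p.[r i] = q.[r i].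
Proof.
move=> symN; pose NC := map_mx f N.
have NC_herm : NC \is hermsymmx.
  apply: realsym_hermsym.
    apply/is_hermitianmxP.
    by rewrite expr0 scale1r map_mx_id// /NC map_trmx symN.
  by apply/mxOverP => i j; rewrite mxE.
have /orthomx_spectralP NCE := hermitian_normalmx NC_herm.
have /mxOverP sp_real := hermitian_spectral_diag_real NC_herm.
set Q := spectralmx NC in NCE; set sp := spectral_diag NC in NCE sp_real.
have Qu : Q \in unitmx by exact: spectral_unit.
have /choice[r spE] : forall i, exists x, sp 0 i = f x by move=> i; exact: f_surj.
exists r.
have hornerE p : map_mx f (horner_mx N p) =
    invmx Q *m diag_mx (\row_i f p.[r i]) *m Q.
  rewrite map_horner_mx -/NC NCE horner_mx_uconjC// horner_mx_diag.
  congr (_ *m diag_mx _ *m _).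
  by apply/rowP => i; rewrite !mxE spE horner_map.
move=> p q; split=> [epq i|epq].
  have := hornerE p; rewrite epq hornerE => /(congr1 (fun X => Q *m X *m invmx Q)).
  rewrite !mulmxA !mulmxV// !mul1mx -!mulmxA !mulmxV// !mulmx1.
  by move=> /matrixP/(_ i i); rewrite !mxE eqxx !mulr1n => /fmorph_inj.
apply: (@map_mx_inj _ _ f) => //; rewrite !hornerE; congr (_ *m diag_mx _ *m _).
by apply/rowP => i; rewrite !mxE epq.
Qed.

(** The projections are the Lagrange interpolation polynomials of the distinct eigenvalues,
    evaluated at [N]. As polynomials in [N] they are symmetric, and none is 0 because each takes the
    value 1 at its own eigenvalue. *)
Lemma symmetric_resolution n (N : 'M[R]_n.+1) : N^T = N ->
  exists (k : nat) (r : 'I_k -> R) (E : 'I_k -> 'M[R]_n.+1),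
    [/\ resolution N r E, forall i, (E i)^T = E i
      & forall i, E i != 0].
Proof.
move=> symN; have [||r0 r0E] := @horner_mx_spectral R[i] (real_complex R) _ _ n N symN.
  by move=> x; apply/complex_realP; exists x.
  by move=> z /complex_realP.
(* Repetitions are removed so that the denominators [r j - r i] of the interpolation polynomials are
   nonzero for [i != j]. *)
pose s := undup [seq r0 i | i <- enum 'I_n.+1].
have us : uniq s by exact: undup_uniq.
have r0s i : r0 i \in s by rewrite mem_undup map_f// mem_enum.
pose r (j : 'I_(size s)) := s`_j.
have r_inj i j : (r i == r j) = (i == j) by rewrite /r nth_uniq.
have rP i : exists j, r0 i = r j.
  have lt : (index (r0 i) s < size s)%N by rewrite index_mem.
  by exists (Ordinal lt); rewrite /r /= nth_index.
have rQ j : exists i, r j = r0 i.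
  have : r j \in s by rewrite mem_nth.
  by rewrite mem_undup => /mapP[i _ ->]; exists i.
pose l (j : 'I_(size s)) : {poly R} :=
  \prod_(i | i != j) ((r j - r i)^-1 *: ('X - (r i)%:P)).
have lE j i : (l j).[r i] = (i == j)%:R.
  rewrite /l horner_prod; have [->|nij] := eqVneq i j.
    rewrite big1// => i' ni; rewrite !hornerE mulVf// subr_eq0 r_inj eq_sym.
    by [].
  by rewrite (bigD1 i)//= !hornerE subrr mulr0 mul0r.
exists (size s), r, (fun j => horner_mx N (l j)); split.
- split.
  + move=> i j.
    have -> : horner_mx N (l i) *m horner_mx N (l j) = horner_mx N (l i * l j).
      by rewrite rmorphM.
    have [<-|nij] := eqVneq i j.
      apply/r0E => i'; have [j' ->] := rP i'; rewrite hornerM lE.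
      by case: (_ == _); rewrite ?mulr1 ?mulr0.
    rewrite -[RHS](rmorph0 (horner_mx N)); apply/r0E => i'.
    have [j' ->] := rP i'; rewrite hornerM !lE horner0.
    have [->|] := eqVneq j' i; last by rewrite mul0r.
    by rewrite (negPf nij) mulr0.
  + rewrite -rmorph_sum /= -[1%:M](rmorph1 (horner_mx N)).
    apply/r0E => i'; have [j' ->] := rP i'; rewrite horner_sum hornerC.
    rewrite (bigD1 j')//= lE eqxx big1 ?addr0// => i ni.
    by rewrite lE eq_sym (negPf ni).
  + under eq_bigr do rewrite -linearZ.
    rewrite -rmorph_sum /= -{1}(horner_mx_X N).
    apply/r0E => i'; have [j' ->] := rP i'; rewrite horner_sum hornerX.
    rewrite (bigD1 j')//= hornerZ lE eqxx mulr1 big1 ?addr0// => i ni.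
    by rewrite hornerZ lE eq_sym (negPf ni) mulr0.
- by move=> i; rewrite horner_mx_sym.
- move=> j; apply/eqP; rewrite -[RHS](rmorph0 (horner_mx N)) => /r0E.
  have [i ri] := rQ j; move=> /(_ i); rewrite -ri lE eqxx horner0.
  by move/eqP; rewrite oner_eq0.
Qed.

End Resolution.

(** * Exponential, eigenvalues and spectral projections read off from a resolution *)

Lemma cvg_sumr (R : realType) (V : normedModType R) (T : Type) (F : set_system T)
    (FF : Filter F) (I : finType) (f : I -> T -> V) (l : I -> V) :
  (forall i, f i x @[x --> F] --> l i) ->
  \sum_i f i x @[x --> F] --> \sum_i l i.
Proof.
move=> fl; elim: (index_enum I) => [|i s IH].
  rewrite big_nil; under eq_fun do rewrite big_nil; exact: cvg_cst.
by rewrite big_cons; under eq_fun do rewrite big_cons; exact: cvgD.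
Qed.

Section ResolutionTheory.
Context {R : realType}.
Variables (I : finType) (m : nat).
Implicit Types (A : 'M[R]_m) (r : I -> R) (P : I -> 'M[R]_m).

Lemma resolution_mulmx A r P (i : I) : resolution A r P ->
  P i *m A = r i *: P i.
Proof.
move=> [PP _ ->]; rewrite mulmx_sumr (bigD1 i)//= big1 ?addr0.
  by rewrite -scalemxAr PP eqxx.
by move=> j ji; rewrite -scalemxAr PP eq_sym (negPf ji) scaler0.
Qed.

Lemma resolution_affine A r P (t nu : R) : resolution A r P ->
  resolution (t *: (A - nu%:M)) (fun i => t * (r i - nu)) P.
Proof.
move=> [PP P1 ->]; split=> //; under [RHS]eq_bigr do rewrite -scalerA.
rewrite -scaler_sumr; congr (_ *: _).
under [RHS]eq_bigr do rewrite scalerBl.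
by rewrite sumrB -[in RHS]scaler_sumr P1 scalemx1.
Qed.

Lemma resolution_exp A r P (k : nat) : resolution A r P ->
  A ^+ k = \sum_i r i ^+ k *: P i.
Proof.
move=> res; have [PP P1 _] := res; elim: k => [|k IH].
  by rewrite expr0; under eq_bigr do rewrite expr0 scale1r; rewrite P1.
rewrite exprSr IH; transitivity (\sum_i (r i ^+ k *: P i) *m A).
  by rewrite -mulmx_suml.
by apply: eq_bigr => i _; rewrite -scalemxAl (resolution_mulmx _ _ _ i res) scalerA exprSr.
Qed.

(** The partial sums of the matrix series are those of the scalar exponential series at [r i],
    carried by [P i]. *)
Lemma resolution_expmx A r P : resolution A r P ->
  expmx A = \sum_i expR (r i) *: P i.
Proof.
move=> res; apply/cvg_lim => //.
have -> : series (fun k => (k`!%:R : R)^-1 *: A ^+ k) =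
    (fun k => \sum_i series (exp_coeff (r i)) k *: P i).
  apply/funext => k; rewrite /series /=.
  under [RHS]eq_bigr do rewrite scaler_suml.
  rewrite exchange_big /=; apply: eq_bigr => j _.
  rewrite (resolution_exp _ _ _ _ res) scaler_sumr; apply: eq_bigr => i _.
  by rewrite scalerA /exp_coeff /= mulrC.
apply: cvg_sumr => i; apply: cvgZr_tmp.
exact: is_cvg_series_exp_coeff.
Qed.

(** The predicate [eigenvalue] speaks of row vectors, and any nonzero row of [P i] is a left
    eigenvector. *)
Lemma resolution_eigenvalue A r P (i : I) : resolution A r P ->
  P i != 0 -> eigenvalue A (r i).
Proof.
move=> res; apply: contraNT => /eigenvalueP noev; apply/eqP/row_matrixP => j.
rewrite row0; apply/eqP/negP => /negP Pj0; apply: noev.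
by exists (row j (P i)) => //; rewrite -row_mul (resolution_mulmx _ _ _ i res) linearZ.
Qed.

(** [P i] turns [(A - a)^k] into the scalar [(r i - a)^k], which is nonzero here. *)
Lemma resolution_generalized_eigenvector (C : fieldType) (f : {rmorphism R -> C})
    A r P (a : C) (k : nat) (v : 'cV[C]_m) (i : I) : resolution A r P ->
  (map_mx f A - a%:M) ^+ k *m v = 0 -> f (r i) != a -> map_mx f (P i) *m v = 0.
Proof.
move=> res Akv ria.
have PA : map_mx f (P i) *m (map_mx f A - a%:M) = (f (r i) - a) *: map_mx f (P i).
  rewrite mulmxBr -map_mxM (resolution_mulmx _ _ _ i res) map_mxZ scalar_mxC.
  by rewrite mul_scalar_mx scalerBl.
have PAk : map_mx f (P i) *m (map_mx f A - a%:M) ^+ k =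
    (f (r i) - a) ^+ k *: map_mx f (P i).
  elim: k {Akv} => [|k IH]; first by rewrite !expr0 mulmx1 scale1r.
  by rewrite [in LHS]exprS mulmxA PA -scalemxAl IH scalerA -exprS.
have := congr1 (mulmx (map_mx f (P i))) Akv.
rewrite mulmx0 mulmxA PAk -scalemxAl => /eqP; rewrite scaler_eq0.
by rewrite expf_eq0 subr_eq0 (negPf ria) andbF => /eqP.
Qed.

(** A generalized eigenvector [v] for [a] is the sum of the [P i v], and only the terms with
    [r i = a] survive; these are either all selected by [X] or all rejected. *)
Lemma resolution_spectral_projection A r P (S : set R[i]) (X : pred I) :
  resolution A r P -> (forall i, X i <-> S (real_complex R (r i))) ->
  is_spectral_projection S A (\sum_(i | X i) P i).
Proof.
move=> res XS AC PC a v Av; rewrite {}/PC.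
have Pv i := resolution_generalized_eigenvector R[i] (real_complex R) A r P a m v i res Av.
have vE : v = \sum_i map_mx (real_complex R) (P i) *m v.
  rewrite -mulmx_suml -raddf_sum; case: res => _ -> _.
  by rewrite /= map_mx1 mul1mx.
rewrite raddf_sum mulmx_suml; split=> Sa.
  rewrite [RHS]vE big_mkcond /=; apply: eq_bigr => i _; case: ifPn => // /negP nX.
  rewrite Pv//; apply/eqP => ria; apply: nX; apply/XS.
  by rewrite ria.
apply: big1 => i /XS Sr; apply: Pv; apply/eqP => ria.
by apply: Sa; rewrite -ria.
Qed.

End ResolutionTheory.

(** * Spectral projections of a second-order system written in first-order form *)

Section Hamiltonian.
Context {R : realType}.

Lemma resolution_conj (I : finType) m (T T' A : 'M[R]_m) (r : I -> R)
    (P : I -> 'M[R]_m) : T *m T' = 1%:M -> resolution A r P ->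
  resolution (T' *m A *m T) r (fun i => T' *m P i *m T).
Proof.
move=> TT' [PP P1 ->]; have T'T := mulmx1C TT'; split.
- move=> i j; rewrite -!mulmxA (mulmxA T T') TT' mul1mx (mulmxA (P i)) PP.
  by case: eqP => // _; rewrite ?mul0mx ?mulmx0.
- by rewrite -mulmx_suml -mulmx_sumr P1 mulmx1.
- rewrite mulmx_sumr mulmx_suml; apply: eq_bigr => i _.
  by rewrite -scalemxAr -scalemxAl.
Qed.

Definition bsign (b : bool) : R := if b then 1 else -1.

(* The spectral projections of the first-order form of [v'' = N v], where the
   eigenvalues of [N] are the squares of the [nu i]. *)
Definition second_order_proj {I : Type} {n} (nu : I -> R) (E : I -> 'M[R]_n)
    (x : bool * I) : 'M[R]_(n + n) :=
  2^-1 *: block_mx (E x.2) ((bsign x.1 / nu x.2) *: E x.2)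
                   ((bsign x.1 * nu x.2) *: E x.2) (E x.2).

Lemma sum_bool_pair (V : nmodType) (I : finType) (F : bool * I -> V) :
  \sum_x F x = \sum_i F (true, i) + \sum_i F (false, i).
Proof.
rewrite -(big_bool _ (fun b => \sum_i F (b, i))) pair_bigA /=.
by apply: eq_bigr => -[].
Qed.

Lemma sum_block_mx (I : finType) n1 n2 n3 n4 (A : I -> 'M[R]_(n1, n3))
    (B : I -> 'M[R]_(n1, n4)) (C : I -> 'M[R]_(n2, n3)) (D : I -> 'M[R]_(n2, n4)) :
  \sum_i block_mx (A i) (B i) (C i) (D i) =
  block_mx (\sum_i A i) (\sum_i B i) (\sum_i C i) (\sum_i D i).
Proof.
elim: (index_enum I) => [|i s IH]; last by rewrite !big_cons IH add_block_mx.
by rewrite !big_nil /block_mx !row_mx0 col_mx0.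
Qed.

(** The eigenvalues are the two square roots of each [nu i ^+ 2]. For a fixed [i], the product of
    the projections of signs [b] and [c] carries the factor [(1 + b c) / 2], which is 1 for equal
    signs and 0 for opposite ones. *)
Lemma second_order_resolution (I : finType) n (N : 'M[R]_n) (nu : I -> R)
    (E : I -> 'M[R]_n) : (forall i, nu i != 0) ->
  resolution N (fun i => nu i ^+ 2) E ->
  resolution (block_mx 0 1%:M N 0)
    (fun x => bsign x.1 * nu x.2) (second_order_proj nu E).
Proof.
move=> nu0 [EE E1 NE]; split.
- move=> [b i] [c j]; rewrite /second_order_proj /= -scalemxAl -scalemxAr.
  rewrite mulmx_block -!(scalemxAl, scalemxAr) !EE.
  have [<-|nij] := eqVneq i j; last first.
    rewrite xpair_eqE (negPf nij) andbF !scaler0 !addr0.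
    by rewrite /block_mx !row_mx0 col_mx0 !scaler0.
  rewrite xpair_eqE eqxx andbT !scalerA !scale_block_mx.
  transitivity ((b == c)%:R *: block_mx (2^-1 *: E i) ((2^-1 * (bsign b / nu i)) *: E i)
      ((2^-1 * (bsign b * nu i)) *: E i) (2^-1 *: E i)); last first.
    case: (b == c); last by rewrite scale0r.
    by rewrite scale1r -!scalerA.
  rewrite scale_block_mx !scalerA; have nui := nu0 i.
  have E2 a : E i + a *: E i = (1 + a) *: E i by rewrite scalerDl scale1r.
  have E2' a : a *: E i + E i = (a + 1) *: E i by rewrite scalerDl scale1r.
  rewrite E2 E2' -!scalerDl !scalerA.
  have -> : (b == c) = ~~ (b (+) c) by case: (b); case: (c).
  by congr block_mx; congr (_ *: _); case: (b); case: (c); rewrite /bsign /GRing.scale /=; field.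
- rewrite /second_order_proj /= -scaler_sumr sum_bool_pair !sum_block_mx /= add_block_mx.
  rewrite -!big_split /= scale_block_mx scalar_mx_block; congr block_mx.
  + by rewrite big_split /= E1 scalerDr -scalerDl (_ : 2^-1 + 2^-1 = 1) ?scale1r//; field.
  + rewrite big1 ?scaler0// => i _.
    by rewrite -scalerDl /bsign mulN1r mul1r subrr scale0r.
  + rewrite big1 ?scaler0// => i _.
    by rewrite -scalerDl /bsign mulN1r mul1r subrr scale0r.
  + by rewrite big_split /= E1 scalerDr -scalerDl (_ : 2^-1 + 2^-1 = 1) ?scale1r//; field.
- rewrite sum_bool_pair /second_order_proj /=.
  under eq_bigr do rewrite !scale_block_mx.
  under [X in _ = _ + X]eq_bigr do rewrite !scale_block_mx.
  rewrite !sum_block_mx add_block_mx -!big_split /=; congr block_mx.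
  + by rewrite big1// => i _; rewrite !scalerA -scalerDl /bsign; apply/eqP; rewrite scaler_eq0; apply/orP; left; apply/eqP; field.
  + rewrite -E1; apply: eq_bigr => i _; rewrite !scalerA -scalerDl -[LHS]scale1r.
    by congr (_ *: _); rewrite /bsign; have nui := nu0 i; field.
  + rewrite NE; apply: eq_bigr => i _; rewrite !scalerA -scalerDl.
    by congr (_ *: _); rewrite /bsign; field.
  + by rewrite big1// => i _; rewrite !scalerA -scalerDl /bsign; apply/eqP; rewrite scaler_eq0; apply/orP; left; apply/eqP; field.
Qed.
End Hamiltonian.

(** * From the dichotomy constant to a lower bound on the quadratic form of [H] *)

Section DichotomyBound.
Context {R : realType}.

(** This is the limit [t] to [+oo]. For a slack [e], the time [|c| / (e k)] is large enough, since
    [expR s >= 1 + s]. *)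
Lemma le_of_le_addexp (a b c k : R) : 0 < k ->
  (forall t, 0 <= t -> a <= b + c * expR (- (t * k))) -> a <= b.
Proof.
move=> k0 h; apply/ler_addgt0Pr => e e0.
have t0 : 0 <= `|c| / e / k by rewrite !divr_ge0// ltW.
apply: le_trans (h _ t0) _; rewrite lerD2l divfK ?gt_eqF//.
apply: le_trans (ler_norm _) _; rewrite normrM [X in _ * X]ger0_norm ?expR_ge0//.
rewrite expRN ler_pdivrMr ?expR_gt0// -ler_pdivrMl// mulrC.
by apply: le_trans (expR_ge1Dx _); rewrite lerDr.
Qed.

(** With [S] the square root of the diagonal matrix and [S'] its inverse, [S' (- M) S'] is similar
    to [- D^-1 M] but symmetric, and it is positive definite by congruence. Its eigenvalues
    therefore have positive square roots [nu i]. *)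
Lemma scaled_resolution n (d : 'rV[R]_n.+1) (M : 'M[R]_n.+1) :
    (forall j, 0 < d 0 j) -> M^T = M -> negative_definite M ->
  let S := diag_mx (map_mx Num.sqrt d) in
  let S' := diag_mx (map_mx (fun a => (Num.sqrt a)^-1) d) in
  exists (k : nat) (nu : 'I_k -> R) (E : 'I_k -> 'M[R]_n.+1),
    [/\ forall i, 0 < nu i, forall i, (E i)^T = E i, forall i, E i != 0,
        resolution (S' *m - M *m S') (fun i => nu i ^+ 2) E
      & [/\ S *m S' = 1%:M, S' *m S = 1%:M & invmx (diag_mx d) = S' *m S'] ].
Proof.
move=> d0 symM Mneg S S'.
have s0 j : 0 < Num.sqrt (d 0 j) by rewrite sqrtr_gt0.
have SS' : S *m S' = 1%:M.
  rewrite mulmx_diag; apply/matrixP => i j; rewrite !mxE; case: eqP => // _.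
  by rewrite mulfV// gt_eqF.
have S'S : S' *m S = 1%:M by exact: mulmx1C.
have symS' : S'^T = S' by exact: tr_diag_mx.
have S2 : diag_mx d = S *m S.
  by rewrite mulmx_diag; congr diag_mx; apply/rowP => i; rewrite !mxE -expr2 sqr_sqrtr// ltW.
have invD : invmx (diag_mx d) = S' *m S'.
  have DS : diag_mx d *m (S' *m S') = 1%:M.
    by rewrite S2 -mulmxA (mulmxA S S') SS' mul1mx.
  have [uD _] := mulmx1_unit DS.
  by rewrite -[RHS](mulKmx uD) DS mulmx1.
have symN : (S' *m - M *m S')^T = S' *m - M *m S'.
  by rewrite !trmx_mul symS' linearN /= symM mulmxA.
have [k [r [E [res symE E0]]]] := symmetric_resolution n _ symN.
(* A nonzero column [v] of [E i] is an eigenvector, and [r i |v|^2 = v . N v] is the value of the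
   form of [- M] at [S' v]. *)
have r0 i : 0 < r i.
  have [j Ej0] : exists j, col j (E i) != 0.
    apply/existsP; apply: contraNT (E0 i); rewrite negb_exists => /forallP Ei.
    apply/eqP/matrixP => a b; move: (Ei b); rewrite negbK => /eqP/colP/(_ a).
    by rewrite !mxE.
  set v := col j (E i) in Ej0.
  have Nv : (S' *m - M *m S') *m v = r i *: v.
    rewrite /v colE mulmxA -[_ *m E i]trmxK trmx_mul symN symE.
    by rewrite (resolution_mulmx _ _ _ _ _ i res) linearZ /= symE scalemxAl.
  have S'v : S' *m v != 0.
    by apply: contra_neq Ej0 => S'v; rewrite -[v]mul1mx -SS' -mulmxA S'v mulmx0.
  have v_gt0 : 0 < dot v v.
    by rewrite lt_def dot_ge0 andbT; apply: contra_neq Ej0; exact: dot_eq0.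
  rewrite -(pmulr_lgt0 _ v_gt0) -dotZr -Nv.
  rewrite -!mulmxA dot_mulmxr symS' mulNmx dotNr oppr_gt0.
  by have := Mneg _ S'v; rewrite -mulmxA.
exists k, (fun i => Num.sqrt (r i)), E; split=> //.
- by move=> i; rewrite sqrtr_gt0.
- case: res => EE E1 NE; split=> //; rewrite {1}NE; apply: eq_bigr => i _.
  by rewrite sqr_sqrtr// ltW.
Qed.

Lemma dichotomy_lower_bound n (d : 'rV[R]_n.+1) (M : 'M[R]_n.+1) (K eta : R) :
    0 < K -> (forall j, 0 < d 0 j) -> M^T = M -> negative_definite M ->
    dichotomy_bounds (coef_mx d M) K eta ->
  exists H : 'M[R]_n.+1,
    [/\ H^T = H, H *m invmx (diag_mx d) *m H = - M
      & forall u, dot u u <= 4 * K * dot u (H *m u)].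
Proof.
move=> K0 d0 symM Mneg dich.
have [k [nu [E [nu0 symE E0 res [SS' S'S invD]]]]] := scaled_resolution n d M d0 symM Mneg.
set S := diag_mx _ in SS' S'S; set S' := diag_mx _ in res SS' S'S invD.
set N := S' *m - M *m S' in res; set D' := invmx _ in invD *.
have [EE E1 NE] := res.
have symS : S^T = S by exact: tr_diag_mx.
have symS' : S'^T = S' by exact: tr_diag_mx.
have nu_neq0 i : nu i != 0 by rewrite gt_eqF.
(* The change of variables [(u, w)] to [(S u, S' w)] brings [coef_mx d M] to the first-order form of
   [v'' = N v]. *)
pose T := block_mx S 0 0 S'; pose T' := block_mx S' 0 0 S.
have TT' : T *m T' = 1%:M.
  by rewrite mulmx_block !mulmx0 !mul0mx !addr0 !add0r SS' S'S -scalar_mx_block.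
have coefE : coef_mx d M = T' *m block_mx 0 1%:M N 0 *m T.
  rewrite /coef_mx -/D' invD !mulmx_block !(mulmx0, mul0mx, addr0, add0r, mulmx1).
  congr block_mx; rewrite /N -!mulmxA S'S mulmx1 mulmxA SS' mul1mx.
  by [].
pose Q := second_order_proj nu E.
pose P := fun x => T' *m Q x *m T.
pose rr := fun x : bool * 'I_k => bsign x.1 * nu x.2.
have resA : resolution (coef_mx d M) rr P.
  rewrite coefE; apply: resolution_conj => //.
  exact: (second_order_resolution _ _ N nu E nu_neq0 res).
(* The index type is not empty: otherwise the [E i] would sum to 0 instead of the identity. *)
have [i0 nu_min] : exists i0, forall i, nu i0 <= nu i.
  have [j0 _|k0] := pickP (fun _ : 'I_k => true).
    by exists [arg min_(i < j0) nu i]%O => i; case: arg_minP => // j _; apply.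
  move/matrixP/(_ 0 0): E1; rewrite big_pred0; last by move=> i; have := k0 i.
  by rewrite !mxE => /eqP; rewrite eq_sym oner_eq0.
pose nu1 := nu i0.
have nu1_gt0 : 0 < nu1 by exact: nu0.
have ev : eigenvalue (coef_mx d M) nu1.
  have := @resolution_eigenvalue _ _ _ _ _ _ (true, i0) resA.
  rewrite /rr /= mul1r; apply.
  apply: contra_neq (E0 i0) => P0.
  have : Q (true, i0) = 0.
    have := congr1 (fun X => T *m X *m T') P0.
    by rewrite /P mulmx0 mul0mx !mulmxA TT' mul1mx -mulmxA TT' mulmx1.
  rewrite /Q /second_order_proj /= => /eqP; rewrite scaler_eq0 invr_eq0 pnatr_eq0 /=.
  by rewrite block_mx_eq0 => /and4P[/eqP].
have res1 : resolution (coef_mx d M - nu1%:M)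
    (fun x => rr x - nu1) P.
  have := resolution_affine _ _ _ _ _ 1 nu1 resA; rewrite scale1r.
  by rewrite (_ : (fun x => _) = (fun x => rr x - nu1))//; apply/funext => x; rewrite mul1r.
(* By minimality of [nu1], this selects all negative eigenvalues and, among the positive ones, only
   [nu1]. *)
pose X : pred (bool * 'I_k) := fun x => rr x - nu1 <= 0.
have [bnd _] := dich nu1 ev nu1_gt0 (\sum_(x | X x) P x) (\sum_(x | ~~ X x) P x)
  (resolution_spectral_projection _ _ _ _ _ [set a | complex.Re a <= 0] X res1
    (fun x => iff_refl _))
  (resolution_spectral_projection _ _ _ _ _ [set a | 0 < complex.Re a] (fun x => ~~ X x) res1
    (fun x => ltac:(rewrite /X -ltNge; exact: iff_refl))).
(* The upper right block of [e^{t (A - nu1)} Pcs], tested on [q], is [phi (Y t)].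
   The unstable part of [Pcs] is an eigenspace for [nu1], so it does not move, and
   [phi (Y t) - phi (Y 0)] tends to half of the sum on the left. *)
have key q : \sum_i (nu i)^-1 * dot (E i *m (S' *m q)) (E i *m (S' *m q))
    <= 4 * K * dot q q.
  pose p := S' *m q.
  pose f i := (nu i)^-1 * dot (E i *m p) (E i *m p).
  pose phi (Y : 'M[R]_(n.+1 + n.+1)) := dot (col_mx q 0) (Y *m col_mx 0 q).
  have phiP x : phi (P x) = 2^-1 * bsign x.1 * f x.2.
    rewrite /phi /P -!mulmxA dot_mulmxr /T /T' tr_block_mx !trmx0 symS symS'.
    rewrite !mul_block_col !(mulmx0, mul0mx, addr0, add0r) -/p.
    rewrite /Q /second_order_proj -scalemxAl dotZr mul_block_col !(mulmx0, mul0mx, addr0, add0r).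
    rewrite -scalemxAl dot_col_mx dot0l addr0 dotZr /f !mulrA; congr (_ * _); rewrite dot_mulmxr symE.
    by rewrite [RHS]dot_mulmxr symE mulmxA EE eqxx.
  have f_ge0 i : 0 <= f i by rewrite mulr_ge0 ?dot_ge0// invr_ge0 ltW.
  have phi_sum (Z : pred (bool * 'I_k)) (a : bool * 'I_k -> R) :
      phi (\sum_(x | Z x) a x *: P x) = \sum_(x | Z x) a x * (2^-1 * bsign x.1 * f x.2).
    rewrite /phi mulmx_suml dot_sumr; apply: eq_bigr => x _.
    by rewrite -scalemxAl dotZr -phiP.
  have enorm_pad (a b : 'cV[R]_n.+1) : (a == 0) || (b == 0) ->
      enorm (col_mx a b) = enorm (a + b).
    move=> ab0; apply/eqP; rewrite -(@eqrXn2 _ 2) ?enorm_ge0// !sqr_enorm.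
    rewrite dot_col_mx.
    by case/orP: ab0 => /eqP->; rewrite ?add0r ?addr0 dot0l ?addr0 ?add0r.
  have phi_le Y : `|phi Y| <= opnorm Y * dot q q.
    apply: le_trans (dot_opnorm _ _ _ _) _; rewrite !enorm_pad ?eqxx ?orbT//.
    by rewrite addr0 add0r -expr2 sqr_enorm.
  pose Y t := \sum_(x | X x) expR (t * (rr x - nu1)) *: P x.
  have YK t : 0 <= t -> `|phi (Y t)| <= K * dot q q.
    move=> t0; apply: le_trans (phi_le _) _; apply: ler_wpM2r; first exact: dot_ge0.
    (* The dichotomy bound is taken between the points [- t] and [0], so that the elapsed time is
       [t]. Orthogonality of the projections then reduces the exponential times [Pcs] to [Y t]. *)
    have mt0 : - t <= 0 by rewrite oppr_le0.
    have := bnd 0 (- t) mt0 (lexx _); rewrite sub0r opprK.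
    rewrite (resolution_expmx _ _ _ _ _ (resolution_affine _ _ _ _ _ t nu1 resA)).
    congr (opnorm _ <= _); rewrite mulmx_suml /Y (bigID X) /= [X in _ + X]big1 ?addr0.
      apply: eq_bigr => x Xx; rewrite -scalemxAl mulmx_sumr; congr (_ *: _).
      rewrite (bigD1 x)//= big1 ?addr0; first by case: resA => PP _ _; rewrite PP eqxx.
      by move=> y /andP[_ yx]; case: resA => PP _ _; rewrite PP eq_sym (negPf yx).
    move=> x nXx; rewrite -scalemxAl mulmx_sumr big1 ?scaler0// => y Xy.
    case: resA => PP _ _; rewrite PP; case: eqP => // xy.
    by move: nXx; rewrite xy Xy.
  (* Origin of the factor 4: [phi] is bounded by [K * dot q q] at both times, which gives 2, and the
     projections carry a factor one half, which gives another 2. *)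
  apply: (@le_of_le_addexp _ _ (\sum_i f i) nu1) => // t t0.
  suff : 2^-1 * (1 - expR (- (t * nu1))) * \sum_i f i <= phi (Y t) - phi (Y 0).
    have := YK _ t0; have := YK 0 (lexx _); rewrite !ler_norml /f.
    by move=> /andP[? ?] /andP[? ?]; lra.
  rewrite /Y !phi_sum -sumrB [leRHS]big_mkcond sum_bool_pair /= -[leLHS]add0r lerD//.
    apply: sumr_ge0 => i _; case: ifPn => //; rewrite /X /rr /= mul1r => Xi.
    have -> : nu i - nu1 = 0 by apply/eqP; rewrite eq_le Xi subr_ge0 nu_min.
    by rewrite !mulr0 subrr.
  (* The negative eigenvalues remain. After the shift their exponents [- nu i - nu1] are at most
     [- nu1], so these terms decay at least as fast as [expR (- (t * nu1))]. *)
  rewrite mulr_sumr; apply: ler_sum => i _.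
  have -> : X (false, i).
    by rewrite /X /rr /= mulN1r -opprD oppr_le0 addr_ge0// ltW.
  have le_exp : expR (t * (rr (false, i) - nu1)) <= expR (- (t * nu1)).
    rewrite ler_expR -mulrN ler_wpM2l// /rr /= mulN1r.
    by rewrite gerDr oppr_le0 ltW.
  rewrite mul0r expR0 /= -subr_ge0.
  set e1 := expR _ in le_exp *; set e2 := expR _ in le_exp *.
  have -> : e1 * (2^-1 * -1 * f i) - 1 * (2^-1 * -1 * f i) - 2^-1 * (1 - e2) * f i
    = 2^-1 * (e2 - e1) * f i by ring.
  by rewrite mulr_ge0 ?f_ge0// mulr_ge0 ?subr_ge0 ?invr_ge0 ?ler0n.
have resH : resolution (\sum_i nu i *: E i) nu E by split.
(* The middle factor is the positive square root of [N], so that [H D^-1 H = S N S = - M]. *)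
exists (S *m (\sum_i nu i *: E i) *m S); split.
- rewrite !trmx_mul symS mulmxA linear_sum /=; congr (_ *m _ *m _).
  by apply: eq_bigr => i _; rewrite linearZ /= symE.
- have <- : S *m N *m S = - M.
    by rewrite /N !mulmxA SS' mul1mx -mulmxA S'S mulmx1.
  rewrite invD NE -(resolution_exp _ _ _ _ _ 2 resH) expr2 -!mulmxA.
  by rewrite (mulmxA S S') SS' mul1mx (mulmxA S' S) S'S mul1mx.
- move=> u; pose v := S *m u; pose p := S' *m u.
  have uu : dot u u = \sum_i dot (E i *m v) (E i *m p).
    transitivity (dot v p).
      by rewrite /v /p dot_mulmxr symS' mulmxA S'S mul1mx.
    rewrite -[p in LHS]mul1mx -E1 mulmx_suml dot_sumr; apply: eq_bigr => i _.
    by rewrite [RHS]dot_mulmxr symE mulmxA EE eqxx [LHS]dot_mulmxr symE.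
  have uHu : dot u (S *m (\sum_i nu i *: E i) *m S *m u) =
      \sum_i nu i * dot (E i *m v) (E i *m v).
    rewrite -!mulmxA dot_mulmxr symS -/v mulmx_suml dot_sumr.
    apply: eq_bigr => i _; rewrite -scalemxAl dotZr; congr (_ * _).
    by rewrite [RHS]dot_mulmxr symE mulmxA EE eqxx [RHS]dotC.
  have c0 : 0 < 4 * K by rewrite mulr_gt0.
  (* Young's inequality with weight [4 K nu i]. Summed over [i], its left side is [2 (u . u)], and
     by [key u] its last term is at most [u . u], which is then absorbed. *)
  have amgm i : 2 * dot (E i *m v) (E i *m p) <=
      4 * K * (nu i * dot (E i *m v) (E i *m v))
      + (4 * K)^-1 * ((nu i)^-1 * dot (E i *m p) (E i *m p)).
    have h0 : 0 <= (4 * K * nu i)^-1 by rewrite invr_ge0 mulr_ge0 ?ltW.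
    have := mulr_ge0 h0 (dot_ge0 _ ((4 * K * nu i) *: (E i *m v) - E i *m p)).
    rewrite !(dotDl, dotDr, dotNl, dotNr, dotZl, dotZr) (dotC _ (E i *m p)).
    set a := dot _ _; set b := dot _ _; set c := dot _ _ => h.
    rewrite -subr_ge0; apply: le_trans h _; rewrite le_eqVlt; apply/orP; left; apply/eqP.
    by field; rewrite nu_neq0 gt_eqF.
  rewrite uHu; have := @ler_sum _ _ (index_enum 'I_k) xpredT _ _ (fun i _ => amgm i).
  rewrite -mulr_sumr -uu big_split /= -!mulr_sumr => h.
  have := ler_wpM2l (ltW (etrans (invr_gt0 (4 * K)) c0)) (key u).
  rewrite mulKf ?gt_eqF// => h'.
  by lra.
Qed.
End DichotomyBound.

(** * Derivatives along solutions and the energy argument *)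

Section Calculus.
Context {R : realType}.

Lemma is_derive_coord m (U : R -> 'cV[R]_m) (t : R) (U' : 'cV[R]_m) (i : 'I_m) :
  is_derive t 1 U U' -> is_derive t 1 (fun s => U s i 0) (U' i 0).
Proof.
move=> [dU <-]; split; first by have /derivable_mxP := dU; apply.
by rewrite derive_mx// mxE.
Qed.

Lemma is_derive_sum_fun n (h : 'I_n -> R -> R) (t : R) (dh : 'I_n -> R) :
  (forall i, is_derive t 1 (h i) (dh i)) ->
  is_derive t 1 (fun s => \sum_i h i s) (\sum_i dh i).
Proof.
move=> hh; have := is_derive_sum hh.
by rewrite (_ : \sum_(i < n) h i = fun s => \sum_i h i s)//; apply/funext => s; rewrite fct_sumE.
Qed.

Lemma is_derive_dot m (f g : R -> 'cV[R]_m) (t : R) (f' g' : 'cV[R]_m) :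
  (forall i, is_derive t 1 (fun s => f s i 0) (f' i 0)) ->
  (forall i, is_derive t 1 (fun s => g s i 0) (g' i 0)) ->
  is_derive t 1 (fun s => dot (f s) (g s)) (dot f' (g t) + dot (f t) g').
Proof.
move=> df dg; rewrite !dotE -big_split /=.
rewrite (_ : (fun s => _) = (fun s => \sum_i f s i 0 * g s i 0)); last first.
  by apply/funext => s; rewrite dotE.
apply: is_derive_sum_fun => i.
have := is_deriveM (df i) (dg i).
by rewrite /GRing.scale /= addrC [g t i 0 * _]mulrC.
Qed.

Lemma is_derive_mulmx m p (A : 'M[R]_(p, m)) (f : R -> 'cV[R]_m) (t : R) (f' : 'cV[R]_m) :
  (forall i, is_derive t 1 (fun s => f s i 0) (f' i 0)) ->
  forall i, is_derive t 1 (fun s => (A *m f s) i 0) ((A *m f') i 0).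
Proof.
move=> df i; rewrite mxE.
rewrite (_ : (fun s => _) = (fun s => \sum_j A i j * f s j 0)); last first.
  by apply/funext => s; rewrite mxE.
by apply: is_derive_sum_fun.
Qed.

(** The derivative is already the limit of the left difference quotients, and these vanish. This
    serves at the right end of an interval on which the solution is known to be 0. *)
Lemma is_derive_left0 (f : R -> R) (x c : R) :
  is_derive x 1 f c -> (forall t, t <= x -> f t = 0) -> c = 0.
Proof.
move=> [df <-] f0.
have df' : h^-1 *: (f (h *: 1 + x) - f x) @[h --> (0 : R)^'-] --> 'D_1 f x.
  apply: cvg_trans df; apply: cvg_app.
  by apply: within_subset => r /= r0; rewrite lt_eqF.
apply: (cvg_unique _ df') => //.
apply: cvg_near_cst; near=> h.
rewrite !f0 ?lexx ?subrr ?scaler0//.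
rewrite /GRing.scale /= mulr1 gerDr ltW//.
Unshelve. all: by end_near. Qed.

Lemma is_derive_nondecreasing (f df : R -> R) (a b : R) :
  a <= b -> (forall t, t <= b -> is_derive t 1 f (df t)) ->
  (forall t, a <= t -> t <= b -> 0 <= df t) -> f a <= f b.
Proof.
move=> ab fdf df0.
have fd t : t <= b -> derivable f t 1 by move=> /fdf[].
apply: (@ger0_derive1_le_cc _ f a b) => //; rewrite ?in_itv /= ?lexx ?ab//.
- by move=> x; rewrite in_itv /= => /andP[_ /ltW/fd].
- move=> x; rewrite in_itv /= => /andP[/ltW ax /ltW xb]; rewrite derive1E.
  by have [_ ->] := fdf _ xb; exact: df0.
- by apply: derivable_within_continuous => x; rewrite in_itv /= => /andP[_ /fd].
Qed.

(* The weight [g] stands for the primitive of the size of the perturbation; the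
   maximum of [s] bounds [2 q] at the maximum point from above by [g] times
   itself, because [V - q] is almost increasing from minus infinity to that point
   and [V + q] almost increasing from there to [b]. *)
Lemma energy_vanish (V q s g dV dq ds dg : R -> R) (b c : R) :
    (forall t, t <= b -> [/\ is_derive t 1 V (dV t), is_derive t 1 q (dq t),
       is_derive t 1 s (ds t) & is_derive t 1 g (dg t)]) ->
    (forall t, t <= b -> `|dq t| <= dV t + dg t * s t) ->
    (forall t, t <= b -> 0 <= s t <= c * (2 * q t)) ->
    (forall t, t <= b -> 0 <= g t /\ 0 <= dg t) ->
    0 < c -> V b = 0 -> q b = 0 -> c * g b < 1 ->
    V t @[t --> -oo] --> 0 -> q t @[t --> -oo] --> 0 ->
  forall t, t <= b -> s t = 0.
Proof.
move=> der dqV sq g0 c0 Vb qb cg V0 q0 y yb.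
(* The maximum of [s] is taken over the compact interval from [a] to [b]. Afterwards [a] goes to
   minus infinity, where the right-hand side tends to 0. *)
have main a : a <= y -> (1 - c * g b) * s y <= c * (q a - V a).
  move=> ay; have ab := le_trans ay yb.
  have [|z] := @EVT_max _ s a b ab.
    by apply: derivable_within_continuous => x; rewrite in_itv /= => /andP[_ /der[_ _ []]].
  rewrite in_itv /= => /andP[az zb] smax.
  have syz : s y <= s z by apply: smax; rewrite in_itv /= ay yb.
  have [sz0 szq] := andP (sq z zb).
  (* Freezing [s] at its maximum [s z] makes [s z * g] compensate the perturbation [dg t * s t], so
     this combination is nondecreasing; likewise for [V + q] beyond [z]. *)
  have h1 : V a - q a + s z * g a <= V z - q z + s z * g z.
    apply: (@is_derive_nondecreasing (fun t => V t - q t + s z * g t)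
      (fun t => dV t - dq t + s z * dg t)) => // t; first move=> tz.
      have [dVt dqt _ dgt] := der t (le_trans tz zb).
      exact: is_deriveD.
    move=> at_ tz; have tb := le_trans tz zb; have := dqV t tb; rewrite ler_norml => /andP[_ h].
    have [_ dg0] := g0 t tb.
    have : dg t * s t <= dg t * s z by rewrite ler_wpM2l// smax// in_itv /= at_.
    lra.
  have h2 : V z + q z + s z * g z <= V b + q b + s z * g b.
    apply: (@is_derive_nondecreasing (fun t => V t + q t + s z * g t)
      (fun t => dV t + dq t + s z * dg t)) => // t; first move=> tb.
      have [dVt dqt _ dgt] := der t tb.
      exact: is_deriveD.
    move=> zt tb; have := dqV t tb; rewrite ler_norml => /andP[h _].
    have [_ dg0] := g0 t tb.
    have : dg t * s t <= dg t * s z.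
      by rewrite ler_wpM2l// smax// in_itv /= tb (le_trans az).
    lra.
  have [ga0 _] := g0 a ab.
  have h3 : 0 <= s z * g a by rewrite mulr_ge0.
  have h4 : 2 * q z <= s z * g b + (q a - V a) by lra.
  have h5 : c * (2 * q z) <= c * (s z * g b + (q a - V a)) by rewrite ler_wpM2l// ltW.
  have h6 : (1 - c * g b) * s y <= (1 - c * g b) * s z by rewrite ler_wpM2l// subr_ge0 ltW.
  by apply: le_trans h6 _; lra.
have [sy0 _] := andP (sq y yb).
apply/eqP; rewrite eq_le sy0 andbT leNgt; apply/negP => sy_gt0.
(* If [s y] were positive, this threshold would be positive, and [q a - V a] would fall below it for
   some [a <= y], against [main]. *)
pose e := (1 - c * g b) * s y / c.
have e0 : 0 < e by rewrite divr_gt0// mulr_gt0// subr_gt0.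
have qV : q t - V t @[t --> -oo] --> (0 : R) by rewrite -[0]subr0; exact: cvgB.
have : \forall a \near -oo, a <= y /\ q a - V a < e.
  near=> a; split; first by near: a; apply: nbhs_ninfty_le; exact: num_real.
  by near: a; exact: (cvgr_lt 0).
move=> /filter_ex[a [ay]]; rewrite /e ltr_pdivlMr// mulrC ltNge.
by rewrite main.
Unshelve. all: by end_near. Qed.

End Calculus.

(** * Coordinatewise limits, the smallness condition and the inverse diagonal matrix *)

Section Limits.
Context {R : realType}.

Lemma cvg_coord (T : Type) (F : set_system T) (FF : Filter F) m p
    (f : T -> 'M[R]_(m, p)) (l : 'M[R]_(m, p)) i j :
  f x @[x --> F] --> l -> f x i j @[x --> F] --> l i j.
Proof.
move=> fl; apply: (@cvg_comp _ _ _ f (fun X : 'M[R]_(m, p) => X i j)); first exact: fl.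
exact: coord_continuous.
Qed.

Lemma cvg_dot0 (T : Type) (F : set_system T) (FF : Filter F) m (f g : T -> 'cV[R]_m) :
  (forall i, f x i 0 @[x --> F] --> (0 : R)) ->
  (forall i, g x i 0 @[x --> F] --> (0 : R)) ->
  dot (f x) (g x) @[x --> F] --> (0 : R).
Proof.
move=> f0 g0; rewrite (_ : (fun x => _) = (fun x => \sum_i f x i 0 * g x i 0)).
  have s0 : \sum_(i < m) (0 : R) = 0 by rewrite big1.
  rewrite -[X in _ --> X]s0.
  apply: cvg_sumr => i; rewrite -[X in _ --> X](mulr0 0); exact: cvgM.
by apply/funext => x; rewrite dotE.
Qed.

Lemma cvg_mulmx0 (T : Type) (F : set_system T) (FF : Filter F) m p
    (A : 'M[R]_(p, m)) (f : T -> 'cV[R]_m) :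
  (forall i, f x i 0 @[x --> F] --> (0 : R)) ->
  forall i, (A *m f x) i 0 @[x --> F] --> (0 : R).
Proof.
move=> f0 i; rewrite (_ : (fun x => _) = (fun x => \sum_j A i j * f x j 0)).
  have s0 : \sum_(i < m) (0 : R) = 0 by rewrite big1.
  rewrite -[X in _ --> X]s0.
  apply: cvg_sumr => j; rewrite -[X in _ --> X](mulr0 (A i j)).
  by apply: cvgM => //; exact: cvg_cst.
by apply/funext => x; rewrite mxE.
Qed.

(** The right-hand side of the smallness condition is at most 1, because [dmin d <= dmax d] and the
    other two factors of the denominator are at least 1. Then [l / (1 - l) < 1], that is,
    [2 * l < 1]. *)
Lemma lambdaT_lt_half n (d : 'rV[R]_n) (M : 'M[R]_n) (l : R) : (0 < n)%N ->
  l < 1 -> l / (1 - l) < Num.sqrt (dmin d) /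
    (Num.sqrt (dmax d) * Num.sqrt (1 + opnorm M * dmax d) * Num.sqrt n%:R) ->
  2 * l < 1.
Proof.
move=> n0 l1 lsmall.
suff : l / (1 - l) < 1 by rewrite ltr_pdivrMr ?subr_gt0//; lra.
apply: lt_le_trans lsmall _.
have sqrt1 (a : R) : 1 <= a -> 1 <= Num.sqrt a by move=> a1; rewrite -[leLHS]sqrtr1 ler_wsqrtr.
have dmax0 : 0 <= dmax d by exact: bigmax_ge_id.
have dmm : dmin d <= dmax d by exact: bigmin_le_id.
have h1 : 1 <= Num.sqrt (1 + opnorm M * dmax d).
  by rewrite sqrt1// lerDl mulr_ge0// opnorm_ge0.
have h2 : 1 <= Num.sqrt (n%:R : R) by rewrite sqrt1// ler1n.
have h3 : Num.sqrt (dmax d) <=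
    Num.sqrt (dmax d) * Num.sqrt (1 + opnorm M * dmax d) * Num.sqrt n%:R.
  by rewrite -mulrA ler_peMr ?sqrtr_ge0// mulr_ege1.
(* Here the denominator is 0, and the quotient is 0 by the convention on the inverse of 0. *)
have [s0|s0] := eqVneq (Num.sqrt (dmax d)) 0; first by rewrite s0 !mul0r invr0 mulr0.
have {}s0 : 0 < Num.sqrt (dmax d) by rewrite lt_def s0 sqrtr_ge0.
rewrite ler_pdivrMr ?mul1r; last exact: lt_le_trans h3.
by apply: le_trans h3; rewrite ler_wsqrtr.
Qed.

Lemma invmx_diag n (d : 'rV[R]_n) : (forall j, 0 < d 0 j) ->
  [/\ diag_mx d *m invmx (diag_mx d) = 1%:M, (invmx (diag_mx d))^T = invmx (diag_mx d)
    & forall v, 0 <= dot v (invmx (diag_mx d) *m v)].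
Proof.
move=> d0; pose D' := diag_mx (map_mx (@GRing.inv R) d).
have DD' : diag_mx d *m D' = 1%:M.
  rewrite mulmx_diag; apply/matrixP => i j; rewrite !mxE; case: eqP => // _.
  by rewrite mulfV// gt_eqF.
have [uD _] := mulmx1_unit DD'.
have -> : invmx (diag_mx d) = D' by rewrite -[RHS](mulKmx uD) DD' mulmx1.
split=> [//||v]; first exact: tr_diag_mx.
rewrite dotE; apply: sumr_ge0 => i _; rewrite mul_diag_mx !mxE mulrCA.
by apply: mulr_ge0; [rewrite invr_ge0 ltW | rewrite -expr2 sqr_ge0].
Qed.

End Limits.

(** * Trivial intersection of the unstable space with the Dirichlet subspace *)

Theorem proposition2p5 (R : realType) (n : nat) (hn : (0 < n)%N)
  (M : R -> 'M[R]_n) (Mp Mm : 'M[R]_n) (CM etaM : R)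
  (d : 'rV[R]_n) (Km etam Lm : R)
  (* (H1) *)
  (M_cont : continuous M)
  (M_sym : forall x : R, (M x)^T = M x)
  (* (H2) *)
  (M_limp : M x @[x --> +oo] --> Mp)
  (M_limm : M x @[x --> -oo] --> Mm)
  (Mp_neg : negative_definite Mp)
  (Mm_neg : negative_definite Mm)
  (Mp_dist : distinct_eigenvalues Mp)
  (Mm_dist : distinct_eigenvalues Mm)
  (* (H3) *)
  (CM_gt0 : 0 < CM) (etaM_gt0 : 0 < etaM)
  (M_expp : forall x : R, 0 <= x ->
     opnorm (M x - Mp) <= CM * expR (- etaM * `|x|))
  (M_expm : forall x : R, x <= 0 ->
     opnorm (M x - Mm) <= CM * expR (- etaM * `|x|))
  (d_gt0 : forall j : 'I_n, 0 < d 0 j)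
  (Km_gt0 : 0 < Km) (etam_gt0 : 0 < etam)
  (Km_bounds : dichotomy_bounds (coef_mx d Mm) Km etam)
  (Lm_gt0 : 0 < Lm)
  (lambda_lt1 : lambdaT Km CM etaM Lm < 1)
  (lambda_small :
     lambdaT Km CM etaM Lm / (1 - lambdaT Km CM etaM Lm)
     < Num.sqrt (dmin d)
       / (Num.sqrt (dmax d) * Num.sqrt (1 + opnorm Mm * dmax d)
          * Num.sqrt n%:R)) :
  forall x : R, x <= - Lm ->
    Eu_minus (fun t => coef_mx d (M t)) x `&` @Dirichlet R n = [set 0].
Proof.
case: n hn M Mp Mm d M_cont M_sym M_limp M_limm Mp_neg Mm_neg Mp_dist Mm_dist
  M_expp M_expm d_gt0 Km_bounds lambda_small => // n _ M Mp Mm d _ M_sym _ M_limm _ Mm_neg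
  _ _ _ M_expm d_gt0 Km_bounds lambda_small x xL.
have lambda_half := lambdaT_lt_half n.+1 d Mm _ isT lambda_lt1 lambda_small.
have Mm_sym : Mm^T = Mm.
  apply/matrixP => i j; rewrite mxE; apply: (cvg_unique _ (cvg_coord _ _ _ _ _ _ _ j i M_limm)) => //.
  rewrite (_ : (fun t => M t j i) = (fun t => M t i j)); first exact: cvg_coord.
  by apply/funext => t; rewrite -[in LHS](M_sym t) mxE.
have [H [symH HDH Hlow]] := dichotomy_lower_bound n d Mm Km etam Km_gt0 d_gt0 Mm_sym Mm_neg Km_bounds.
have [DD' symD' D'_ge0] := invmx_diag n.+1 d d_gt0.
set D' := invmx _ in HDH DD' symD' D'_ge0.
apply/seteqP; split=> [V [[U [dU U0 <-]] /= Ux]|V ->]; last first.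
  split; last by rewrite /Dirichlet /= linear0.
  exists (fun=> 0); split=> //; last exact: cvg_cst.
  by move=> t; rewrite mulmx0; exact: is_derive_cst.
pose u t := usubmx (U t); pose w t := dsubmx (U t).
have Uuw t : U t = col_mx (u t) (w t) by rewrite vsubmxK.
have rhs t : coef_mx d (M t) *m U t = col_mx (D' *m w t) (- M t *m u t).
  by rewrite Uuw mul_block_col !mul0mx add0r addr0.
have du (t : R) i : is_derive t 1 (fun s => u s i 0) ((D' *m w t) i 0).
  have := is_derive_coord _ _ _ _ (lshift n.+1 i) (dU t); rewrite rhs col_mxEu.
  by rewrite (_ : (fun s => _) = (fun s => u s i 0))//; apply/funext => s; rewrite mxE.
have dw (t : R) i : is_derive t 1 (fun s => w s i 0) ((- M t *m u t) i 0).
  have := is_derive_coord _ _ _ _ (rshift n.+1 i) (dU t); rewrite rhs col_mxEd.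
  by rewrite (_ : (fun s => _) = (fun s => w s i 0))//; apply/funext => s; rewrite mxE.
have u0 i : u t i 0 @[t --> -oo] --> (0 : R).
  rewrite (_ : (fun t => _) = (fun t => U t (lshift n.+1 i) 0)).
    have z : (0 : 'cV[R]_(n.+1 + n.+1)) (lshift n.+1 i) 0 = 0 by rewrite mxE.
    rewrite -[X in _ --> X]z.
    exact: (cvg_coord _ _ _ _ _ U _ (lshift n.+1 i) 0 U0).
  by apply/funext => t; rewrite mxE.
have w0 i : w t i 0 @[t --> -oo] --> (0 : R).
  rewrite (_ : (fun t => _) = (fun t => U t (rshift n.+1 i) 0)).
    have z : (0 : 'cV[R]_(n.+1 + n.+1)) (rshift n.+1 i) 0 = 0 by rewrite mxE.
    rewrite -[X in _ --> X]z.
    exact: (cvg_coord _ _ _ _ _ U _ (rshift n.+1 i) 0 U0).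
  by apply/funext => t; rewrite mxE.
have x_lt0 : x < 0 by apply: le_lt_trans xL _; rewrite oppr_lt0.
(* The energies are [V = u . w] and [q = u . H u], the size is [s = |u|^2], and [g] is the
   primitive, vanishing at minus infinity, of the bound on [M t - Mm]. The constant [2 * Km] is half
   of the one in [Hlow], because [s] is compared with [2 q]. *)
have uu0 : forall t, t <= x -> dot (u t) (u t) = 0.
  apply: (@energy_vanish R (fun t => dot (u t) (w t))
    (fun t => dot (u t) (H *m u t)) (fun t => dot (u t) (u t))
    (fun t => CM / etaM * expR (etaM * t))
    (fun t => dot (D' *m w t) (w t) + dot (u t) (- M t *m u t))
    (fun t => dot (D' *m w t) (H *m u t) + dot (u t) (H *m (D' *m w t)))
    (fun t => dot (D' *m w t) (u t) + dot (u t) (D' *m w t))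
    (fun t => CM * expR (etaM * t)) x (2 * Km)).
  - move=> t _; split.
    + exact: is_derive_dot.
    + by apply: is_derive_dot => //; exact: is_derive_mulmx.
    + exact: is_derive_dot.
    + have h : is_derive t 1 (fun s : R => etaM * s) etaM.
        have := @is_deriveZ _ _ _ id etaM t 1 1 (is_derive_id _ _).
        by rewrite /GRing.scale /= mulr1.
      have := is_deriveZ (CM / etaM) (is_derive1_comp (is_derive_expR (etaM * t)) h).
      rewrite /GRing.scale /= [expR _ * etaM]mulrC mulrA divfK ?gt_eqF//.
  - move=> t tx.
    have tle0 : t <= 0 by apply: le_trans tx (ltW x_lt0).
    have pert : `|dot (u t) ((M t - Mm) *m u t)| <= CM * expR (etaM * t) * dot (u t) (u t).
      apply: le_trans (dot_opnorm _ _ _ _) _; rewrite -expr2 sqr_enorm ler_wpM2r ?dot_ge0//.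
      by have := M_expm t tle0; rewrite ler0_norm// mulrNN.
    (* This expands the form of [D^-1] at [w - b H u]; the identity [H D^-1 H = - Mm] turns its last
       term into the form of [- Mm]. The values [b = 1] and [b = -1] give the two sides of the bound
       on the derivative of [q]. *)
    have sq b : 0 <= dot (D' *m w t) (w t) - 2 * b * dot (D' *m w t) (H *m u t)
        + b ^+ 2 * - dot (u t) (Mm *m u t).
      have := D'_ge0 (w t - b *: (H *m u t)).
      rewrite mulmxBr -scalemxAr !(dotDl, dotDr, dotNl, dotNr, dotZl, dotZr).
      have -> : dot (H *m u t) (D' *m (H *m u t)) = - dot (u t) (Mm *m u t).
        by rewrite -{1}symH -dot_mulmxr !mulmxA HDH mulNmx dotNr.
      have -> : dot (w t) (D' *m (H *m u t)) = dot (D' *m w t) (H *m u t).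
        by rewrite [LHS]dot_mulmxr symD'.
      rewrite (dotC _ (w t)) (dotC _ (H *m u t)).
      by move=> h; apply: le_trans h _; rewrite le_eqVlt; apply/orP; left; apply/eqP; ring.
    have -> : dot (u t) (H *m (D' *m w t)) = dot (D' *m w t) (H *m u t).
      by rewrite [LHS]dot_mulmxr symH dotC.
    have ME : dot (u t) (- M t *m u t) =
        - dot (u t) ((M t - Mm) *m u t) - dot (u t) (Mm *m u t).
      by rewrite mulmxBl mulNmx !(dotNr, dotDr); ring.
    rewrite ME; move: pert; rewrite !ler_norml => /andP[p1 p2].
    by have := sq 1; have := sq (-1) => s1 s2; apply/andP; split; lra.
  - move=> t _; rewrite dot_ge0 /=; apply: le_trans (Hlow _) _.
    by rewrite le_eqVlt; apply/orP; left; apply/eqP; ring.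
  - by move=> t _; rewrite !mulr_ge0 ?expR_ge0 ?invr_ge0// ltW.
  - by rewrite mulr_gt0.
  - by rewrite /u Ux dot0l.
  - by rewrite /u Ux dot0l.
  (* Since [x <= - Lm], the product of [2 * Km] and [g x] is at most twice
     [lambdaT Km CM etaM Lm]. *)
  - apply: le_lt_trans lambda_half; rewrite /lambdaT.
    have -> : 2 * Km * (CM / etaM * expR (etaM * x)) = 2 * (Km * CM / etaM * expR (etaM * x)) by ring.
    apply: ler_wpM2l => //; apply: ler_wpM2l.
      by rewrite !mulr_ge0 ?invr_ge0 ?ltW.
    by rewrite ler_expR mulNr -mulrN ler_wpM2l// ltW.
  - exact: cvg_dot0.
  - by apply: cvg_dot0 => //; exact: cvg_mulmx0.
have u_eq0 t : t <= x -> u t = 0 by move=> /uu0/dot_eq0.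
(* The vector [D^-1 w x] is the derivative of [u] at [x], and [u] vanishes up to [x]. *)
have D'w0 : D' *m w x = 0.
  apply/colP => i; rewrite [RHS]mxE; apply: is_derive_left0 (du x i) _ => t tx.
  by rewrite u_eq0// mxE.
have wx : w x = 0 by rewrite -[w x]mul1mx -DD' -mulmxA D'w0 mulmx0.
by rewrite Uuw wx u_eq0// col_mx0.
Qed.
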